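(* Let $c>0$ and let $(\beta_n)$ be a sequence in $[0,1)$ with $\beta_n\to0$ as $n\to\infty$. Then for each $f\in C_{\rho_0}(\mathbb{R}^+)$ and each $\lambda>0$, $$\lim_{n\to\infty}\sup_{x\in[0,\infty)}\frac{|\mathcal{D}_{n,c}^{\beta_n}(f,x)-f(x)|}{(1+x^2)^{1+\lambda}}=0.$$
   Context: For $\beta\in[0,1)$, $x\ge 0$, $n\in\mathbb{N}$ and integers $v\ge0$ let $\omega_\beta(v,nx)=nx(nx+v\beta)^{v-1}\frac{e^{-(nx+v\beta)}}{v!}$. For $c>0$, integers $v\ge1$ and $t\ge0$ let $p_{n,v-1,c}(t)=c\,\frac{\Gamma(n/c+v-1)}{\Gamma(v)\Gamma(n/c)}\cdot\frac{(ct)^{v-1}}{(1+ct)^{n/c+v-1}}$. The modified Jain-Baskakov operators (for $n>3c$) are $$\mathcal{D}_{n,c}^{\beta}(f,x)=\frac{n-c}{c}\sum_{v=1}^{\infty}\omega_\beta(v,nx)\int_0^\infty p_{n,v-1,c}(t)f(t)\,dt+e^{-nx}f(0).$$ With $\rho_0(x)=1+x^2$, $C_{\rho_0}(\mathbb{R}^+)$ is the set of continuous functions $f$ on $[0,\infty)$ such that $|f(x)|\le M_f(1+x^2)$ for some constant $M_f$ and $f(x)/\rho_0(x)$ converges as $x\to\infty$. *)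

(* Defs.v *)
From Stdlib Require Import Reals Factorial.
From Coquelicot Require Import Coquelicot.
Open Scope R_scope.

(* Euler Gamma function, Gamma(s) = int_0^oo t^(s-1) e^(-t) dt
   (used only for arguments s >= 1 below). *)
Definition Gamma (s : R) : R :=
  RInt_gen (fun t => Rpower t (s - 1) * exp (- t))
           (at_point 0) (Rbar_locally p_infty).

Definition omega (beta : R) (v : nat) (y : R) : R :=
  y * (y + INR v * beta) ^ (v - 1) * exp (- (y + INR v * beta)) / INR (Factorial.fact v).

(* p_{n,v-1,c}(t), for v >= 1 *)
Definition p_kernel (n : nat) (v : nat) (c t : R) : R :=
  c * (Gamma (INR n / c + INR v - 1) / (Gamma (INR v) * Gamma (INR n / c)))
    * ((c * t) ^ (v - 1) / Rpower (1 + c * t) (INR n / c + INR v - 1)).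

Definition D_op (n : nat) (c beta : R) (f : R -> R) (x : R) : R :=
  (INR n - c) / c *
    Series (fun k : nat =>
      let v := S k in
      omega beta v (INR n * x) *
      RInt_gen (fun t => p_kernel n v c t * f t) (at_point 0) (Rbar_locally p_infty))
  + exp (- (INR n * x)) * f 0.

Definition C_rho0 (f : R -> R) : Prop :=
  (forall x, 0 <= x ->
     filterlim f (within (fun t => 0 <= t) (locally x)) (locally (f x))) /\
  (exists M, forall x, 0 <= x -> Rabs (f x) <= M * (1 + x ^ 2)) /\
  (exists l : R, is_lim (fun x => f x / (1 + x ^ 2)) p_infty l).

(* Main.v *)
Require Import Defs.
From Stdlib Require Import Reals Factorial Lra Lia Psatz.
From Coquelicot Require Import Coquelicot.
Open Scope R_scope.

(* A quantitative Korovkin argument: [f] is continuous with [|f t| <= M (1 + t^2)], so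
   [|f t - f x| <= e + K (t - x)^2] for [x] in a compact set, and
   [|f t - f x| <= M (2 + 3 x^2) + 2 M (t - x)^2] for every [x]; it is enough that the operator
   fixes constants and that its value at [(t - x)^2] is [o(1) (1 + x^2)], because for large [x]
   the extra weight [(1 + x^2)^lam] absorbs the second bound.

   The moments of the Baskakov kernels are beta integrals, reduced by the functional equation
   of [Gamma].  For the Jain weights, only [b <= 1/2] matters since [b] tends to [0].  Their
   partial sums satisfy [S_(m+1)'(y) = S_m(y + b) - S_(m+1)(y)], and a comparison argument
   gives [0 <= 1 - S_m(y) <= exp y * q^m] with [q < 1]; the first two moments are only bounded,
   from below and from above respectively, which is what the second moment around [x] needs. *)

(** * Improper integrals over the half-line *)

(** A limit in the single variable [T] replaces the product filter of [RInt_gen], so that the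
    arithmetic of [is_lim] applies. *)
Definition improper_integral (f : R -> R) (l : R) : Prop :=
  (forall T, 0 <= T -> ex_RInt f 0 T) /\
  is_lim (fun T => RInt f 0 T) p_infty l.

Lemma improper_integral_is_RInt_gen f l :
  improper_integral f l -> is_RInt_gen f (at_point 0) (Rbar_locally p_infty) l.
Proof.
intros [Hex Hlim] P HP.
destruct (Hlim P HP) as [M HM].
apply Filter_prod with (Q := fun a => a = 0) (R := fun b => Rmax M 0 < b).
- reflexivity.
- exists (Rmax M 0); auto.
- intros a b -> Hb; exists (RInt f 0 b); simpl.
  pose proof (Rmax_l M 0); pose proof (Rmax_r M 0); split.
  + apply (RInt_correct f 0 b), Hex; lra.
  + apply HM; lra.
Qed.

Lemma improper_integral_RInt_gen f l :
  improper_integral f l -> RInt_gen f (at_point 0) (Rbar_locally p_infty) = l.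
Proof.
intros H; apply is_RInt_gen_unique, improper_integral_is_RInt_gen, H.
Qed.

(** The integral ignores the endpoint, and agreement at [t > 0] is all that holds where [Rpower]
    takes junk values at 0. *)
Lemma improper_integral_ext f g l :
  (forall t, 0 < t -> f t = g t) -> improper_integral f l -> improper_integral g l.
Proof.
intros Hfg [Hex Hlim]; split.
- intros T HT; apply (ex_RInt_ext f); [|now apply Hex].
  intros x; rewrite Rmin_left by lra; intros Hx; apply Hfg; lra.
- apply (is_lim_ext_loc (fun T => RInt f 0 T)); [|exact Hlim].
  exists 0; intros T HT; apply RInt_ext.
  intros x; rewrite Rmin_left by lra; intros Hx; apply Hfg; lra.
Qed.

Lemma improper_integral_unique f l1 l2 :
  improper_integral f l1 -> improper_integral f l2 -> l1 = l2.
Proof.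
intros H1 H2; rewrite <- (improper_integral_RInt_gen _ _ H1).
now apply improper_integral_RInt_gen.
Qed.

Lemma improper_integral_scal f k l :
  improper_integral f l -> improper_integral (fun t => k * f t) (k * l).
Proof.
intros [Hex Hlim]; split.
- intros T HT; apply (ex_RInt_scal f 0 T k); auto.
- apply (is_lim_ext_loc (fun T => k * RInt f 0 T)).
  + exists 0; intros T HT; symmetry; apply (RInt_scal f 0 T k), Hex; lra.
  + apply (is_lim_scal_l (fun T => RInt f 0 T) k p_infty l), Hlim.
Qed.

Lemma improper_integral_plus f g l m :
  improper_integral f l -> improper_integral g m ->
  improper_integral (fun t => f t + g t) (l + m).
Proof.
intros [Hf Lf] [Hg Lg]; split.
- intros T HT; apply (ex_RInt_plus f g 0 T); auto.
- apply (is_lim_ext_loc (fun T => RInt f 0 T + RInt g 0 T)).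
  + exists 0; intros T HT; symmetry.
    apply (RInt_plus f g 0 T); [apply Hf | apply Hg]; lra.
  + apply (is_lim_plus' (fun T => RInt f 0 T) (fun T => RInt g 0 T)); auto.
Qed.

Lemma improper_integral_le f g l m :
  (forall t, 0 < t -> f t <= g t) ->
  improper_integral f l -> improper_integral g m -> l <= m.
Proof.
intros Hfg [Hf Lf] [Hg Lg].
apply (is_lim_le_loc (fun T => RInt f 0 T) (fun T => RInt g 0 T) p_infty l m); auto.
exists 0; intros T HT; apply RInt_le; try lra.
- apply Hf; lra.
- apply Hg; lra.
- intros; apply Hfg; lra.
Qed.

Lemma RInt_0_mono f : (forall t, 0 < t -> 0 <= f t) ->
  (forall T, 0 <= T -> ex_RInt f 0 T) ->
  forall T U, 0 <= T <= U -> RInt f 0 T <= RInt f 0 U.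
Proof.
intros Hf Hex T U HTU.
assert (HT : ex_RInt f 0 T) by (apply Hex; lra).
assert (HU : ex_RInt f T U).
{ apply (ex_RInt_Chasles f T 0 U); [now apply ex_RInt_swap | apply Hex; lra]. }
rewrite <- (RInt_Chasles f 0 T U HT HU).
assert (0 <= RInt f T U).
{ apply RInt_ge_0; [lra | auto | intros; apply Hf; lra]. }
unfold plus; simpl; lra.
Qed.

(** The partial integrals increase with [T], so they converge to their supremum. *)
Lemma improper_integral_bounded f B : (forall t, 0 < t -> 0 <= f t) ->
  (forall T, 0 <= T -> ex_RInt f 0 T) ->
  (forall T, 0 <= T -> RInt f 0 T <= B) ->
  exists l, improper_integral f l.
Proof.
intros Hf Hex HB.
pose (E := fun y => exists T, 0 <= T /\ y = RInt f 0 T).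
destruct (completeness E) as [l [Hub Hlub]].
- exists B; intros y [T [HT ->]]; auto.
- exists (RInt f 0 0), 0; split; [lra | auto].
- exists l; split; auto.
  apply is_lim_spec; intros eps; simpl.
  assert (HT : exists T, 0 <= T /\ l - eps < RInt f 0 T).
  { apply Classical_Prop.NNPP; intros Hn.
    assert (l <= l - eps); [|pose proof (cond_pos eps); lra].
    apply Hlub; intros y [T [HT ->]].
    apply Rnot_lt_le; intros Hlt; apply Hn; exists T; auto. }
  destruct HT as [T [HT0 HT]]; exists T; intros U HU.
  pose proof (RInt_0_mono f Hf Hex T U ltac:(lra)).
  assert (RInt f 0 U <= l) by (apply Hub; exists U; split; [lra | auto]).
  apply Rabs_def1; lra.
Qed.

(** The function [f + g] is nonnegative and at most [2 g], so its integral converges by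
    monotonicity; subtracting [g] gives that of [f]. *)
Lemma improper_integral_dominated f g m :
  (forall T, 0 <= T -> ex_RInt f 0 T) ->
  (forall t, 0 < t -> Rabs (f t) <= g t) ->
  improper_integral g m -> exists l, improper_integral f l.
Proof.
intros Hf Hfg Hg.
assert (Hex : forall T, 0 <= T -> ex_RInt (fun t => f t + g t) 0 T).
{ intros T HT; apply (ex_RInt_plus f g 0 T); [auto | now apply Hg]. }
destruct (improper_integral_bounded (fun t => f t + g t) (2 * m)) as [l Hl].
- intros t Ht; specialize (Hfg t Ht); apply Rabs_le_between in Hfg; lra.
- exact Hex.
- intros T HT.
  pose proof (improper_integral_scal g 2 m Hg) as [Hex2 Hlim2].
  apply Rle_trans with (RInt (fun t => 2 * g t) 0 T).
  + apply RInt_le; auto.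
    intros t Ht; specialize (Hfg t (proj1 Ht)); apply Rabs_le_between in Hfg; lra.
  + apply (is_lim_le_loc (fun _ => RInt (fun t => 2 * g t) 0 T)
             (fun U => RInt (fun t => 2 * g t) 0 U) p_infty
             (RInt (fun t => 2 * g t) 0 T) (2 * m)); auto.
    * exists T; intros U HU; apply RInt_0_mono; auto; [|lra].
      intros t Ht; specialize (Hfg t Ht).
      pose proof (Rabs_pos (f t)); lra.
    * apply is_lim_const.
- exists (l + (-1) * m).
  apply (improper_integral_ext (fun t => (f t + g t) + (-1) * g t)).
  + intros; ring.
  + apply improper_integral_plus; [auto | now apply improper_integral_scal].
Qed.

Lemma improper_integral_derive (F f : R -> R) (l : R) :
  (forall t, 0 <= t -> is_derive F t (f t)) ->
  (forall t, 0 <= t -> continuous f t) ->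
  is_lim F p_infty l -> improper_integral f (l - F 0).
Proof.
intros HF Hf Hl.
assert (HI : forall T, 0 <= T -> is_RInt f 0 T (F T - F 0)).
{ intros T HT; apply (is_RInt_derive F f 0 T); rewrite Rmin_left by lra;
    intros x Hx; [apply HF | apply Hf]; lra. }
split.
- intros T HT; exists (F T - F 0); auto.
- apply (is_lim_ext_loc (fun T => F T - F 0)).
  + exists 0; intros T HT; symmetry; apply is_RInt_unique, HI; lra.
  + apply is_lim_minus'; [auto | apply is_lim_const].
Qed.

(** Differentiability of [F] at 0 is not assumed: [pow0 1] has a corner there. The mean value
    theorem shows instead that [RInt f 0 t - F t] is constant. *)
Lemma improper_integral_derive_open (F f : R -> R) (l : R) :
  (forall t, 0 < t -> is_derive F t (f t)) ->
  (forall t, 0 <= t -> continuous F t) ->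
  (forall t, continuous f t) ->
  is_lim F p_infty l -> improper_integral f (l - F 0).
Proof.
intros HF HFc Hf Hl.
assert (Hex : forall T, ex_RInt f 0 T).
{ intros T; apply (ex_RInt_continuous f); intros z _; apply Hf. }
assert (HD : forall t, is_derive (fun T => RInt f 0 T) t (f t)).
{ intros t; apply is_derive_RInt with (a := 0).
  - exists (mkposreal 1 Rlt_0_1); intros y _; apply (RInt_correct f 0 y), Hex.
  - apply Hf. }
assert (HI : forall T, 0 <= T -> RInt f 0 T = F T - F 0).
{ intros T HT.
  destruct (MVT_gen (fun t => RInt f 0 t - F t) 0 T (fun t => f t - f t)) as [z [_ Hz]].
  - rewrite Rmin_left by lra; intros x Hx.
    apply (is_derive_minus (fun T => RInt f 0 T) F x); [apply HD | apply HF; lra].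
  - rewrite Rmin_left by lra; intros x Hx.
    apply continuity_pt_filterlim.
    apply (continuous_minus (fun T => RInt f 0 T) F x).
    + apply ex_derive_continuous; eexists; apply HD.
    + apply HFc; lra.
  - rewrite (RInt_point 0 f) in Hz; unfold zero in Hz; simpl in Hz; lra. }
split.
- intros T _; apply Hex.
- apply (is_lim_ext_loc (fun T => F T - F 0)).
  + exists 0; intros T HT; symmetry; apply HI; lra.
  + apply is_lim_minus'; [auto | apply is_lim_const].
Qed.

(** * The Gamma function *)

(* The continuous extension of [t ^ s] to [t <= 0]: [Rpower 0 s] is the junk value [1]. *)
Definition pow0 (s t : R) : R :=
  if Rle_dec t 0 then if Req_EM_T s 0 then 1 else 0 else Rpower t s.

Lemma pow0_pos s t : 0 < t -> pow0 s t = Rpower t s.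
Proof. intros Ht; unfold pow0; destruct (Rle_dec t 0); [lra | reflexivity]. Qed.

Lemma is_derive_Rpower s t : 0 < t -> is_derive (fun u => Rpower u s) t (s * Rpower t (s - 1)).
Proof. intros Ht; apply is_derive_Reals, derivable_pt_lim_power, Ht. Qed.

Lemma is_derive_pow0 s t : 0 < t -> is_derive (pow0 s) t (s * pow0 (s - 1) t).
Proof.
intros Ht; rewrite pow0_pos by auto.
apply (is_derive_ext_loc (fun u => Rpower u s)).
- exists (mkposreal t Ht); intros u Hu.
  apply Rabs_lt_between' in Hu; simpl in Hu; symmetry; apply pow0_pos; lra.
- now apply is_derive_Rpower.
Qed.

Lemma continuous_pow0 s t : 0 <= s -> continuous (pow0 s) t.
Proof.
intros Hs; destruct (Req_EM_T s 0) as [->|Hs0].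
- apply (continuous_ext (fun _ => 1)); [|apply continuous_const].
  intros u; unfold pow0; destruct (Rle_dec u 0); destruct (Req_EM_T 0 0); try lra.
  rewrite Rpower_O; lra.
- destruct (Rlt_le_dec 0 t) as [Ht|Ht].
  { apply (ex_derive_continuous (pow0 s) t); eexists; now apply is_derive_pow0. }
  intros P [eps HP].
  assert (HE : pow0 s t = 0).
  { unfold pow0; destruct (Rle_dec t 0); destruct (Req_EM_T s 0); lra. }
  rewrite HE in HP.
  exists (mkposreal (Rpower eps (/ s)) (exp_pos _)); intros u Hu; apply HP.
  apply Rabs_lt_between' in Hu; simpl in Hu.
  apply Rabs_lt_between'; unfold pow0.
  pose proof (cond_pos eps).
  destruct (Rle_dec u 0); destruct (Req_EM_T s 0); try lra.
  assert (Rpower u s < eps); [|pose proof (exp_pos (s * ln u)); unfold Rpower in *; lra].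
  replace (pos eps) with (Rpower (Rpower eps (/ s)) s).
  + apply Rlt_Rpower_l; lra.
  + rewrite Rpower_mult, Rinv_l, Rpower_1; auto.
Qed.

(** Apply [ln u <= u] at [u = t / (2 (s + 1))]; this gives [K = (2 (s + 1))^s]. Using [s + 1]
    instead of [s] keeps the quotient meaningful at [s = 0]. *)
Lemma pow0_le_exp s : 0 <= s ->
  exists K, 0 < K /\ forall t, 0 < t -> 0 < pow0 s t <= K * exp (t / 2).
Proof.
intros Hs; exists (exp (s * ln (2 * (s + 1)))); split; [apply exp_pos|].
intros t Ht; rewrite pow0_pos by auto; split; [apply exp_pos|].
unfold Rpower; rewrite <- exp_plus.
assert (Hq : 0 < t / (2 * (s + 1))) by (apply Rdiv_lt_0_compat; lra).
assert (Hln : ln (t / (2 * (s + 1))) <= t / (2 * (s + 1))).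
{ pose proof (exp_ineq1_le (ln (t / (2 * (s + 1))))) as H; rewrite exp_ln in H; lra. }
assert (Hsum : ln t = ln (2 * (s + 1)) + ln (t / (2 * (s + 1)))).
{ rewrite <- ln_mult by lra; f_equal; field; lra. }
assert (Hm : s * (t / (2 * (s + 1))) <= t / 2).
{ replace (t / 2) with (s * (t / (2 * (s + 1))) + t / (2 * (s + 1))) by (field; lra).
  lra. }
assert (Hle : s * ln t <= s * ln (2 * (s + 1)) + t / 2) by (rewrite Hsum; nra).
destruct Hle as [Hlt| ->]; [left; now apply exp_increasing | lra].
Qed.

Lemma is_lim_exp_neg a : 0 < a -> is_lim (fun t => exp (- a * t)) p_infty 0.
Proof.
intros Ha; apply (is_lim_comp exp (fun t => - a * t) p_infty 0 m_infty).
- apply is_lim_exp_m.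
- apply is_lim_spec; intros M; exists (- M / a); intros t Ht.
  apply Rmult_lt_compat_l with (r := a) in Ht; auto.
  replace (a * (- M / a)) with (- M) in Ht by (field; lra); lra.
- exists 0; intros t _; discriminate.
Qed.

Lemma pow0_exp_le s : 0 <= s ->
  exists K, 0 < K /\ forall t, 0 < t -> 0 < pow0 s t * exp (- t) <= K * exp (- / 2 * t).
Proof.
intros Hs; destruct (pow0_le_exp s Hs) as [K [HK H]]; exists K; split; auto.
intros t Ht; specialize (H t Ht); pose proof (exp_pos (- t)).
split; [apply Rmult_lt_0_compat; lra|].
replace (- / 2 * t) with (t / 2 + - t) by field.
rewrite exp_plus, <- Rmult_assoc; apply Rmult_le_compat_r; lra.
Qed.

Lemma is_lim_pow0_exp s : 0 <= s -> is_lim (fun t => pow0 s t * exp (- t)) p_infty 0.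
Proof.
intros Hs; destruct (pow0_exp_le s Hs) as [K [HK H]].
apply (is_lim_le_le_loc (fun _ => 0) (fun t => K * exp (- / 2 * t))).
- exists 0; intros t Ht; specialize (H t Ht); lra.
- apply is_lim_const.
- replace (Finite 0) with (Rbar_mult K 0) by (simpl; f_equal; ring).
  apply (is_lim_scal_l (fun t => exp (- / 2 * t))), is_lim_exp_neg; lra.
Qed.

Lemma continuous_pow0_exp s t : 0 <= s -> continuous (fun u => pow0 s u * exp (- u)) t.
Proof.
intros Hs; apply (continuous_mult (pow0 s) (fun u => exp (- u))).
- now apply continuous_pow0.
- apply (ex_derive_continuous (fun u => exp (- u)) t); auto_derive; auto.
Qed.

(** Convergence comes from domination by a multiple of [exp (- t / 2)]. Writing [pow0] for [Rpower]
    makes the integrand continuous up to 0 without changing it on [t > 0]. *)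
Lemma improper_integral_pow0 s : 1 <= s ->
  improper_integral (fun t => pow0 (s - 1) t * exp (- t)) (Gamma s).
Proof.
intros Hs; destruct (pow0_exp_le (s - 1)) as [K [HK H]]; [lra|].
assert (Hex : exists l, improper_integral (fun t => pow0 (s - 1) t * exp (- t)) l).
{ apply (improper_integral_dominated _ (fun t => K * exp (- / 2 * t)) (K * (0 - - 2 * exp (- / 2 * 0)))).
  - intros T HT; apply (ex_RInt_continuous (fun t => pow0 (s - 1) t * exp (- t))).
    intros z _; apply continuous_pow0_exp; lra.
  - intros t Ht; specialize (H t Ht); rewrite Rabs_pos_eq; lra.
  - apply improper_integral_scal.
    apply (improper_integral_derive (fun t => - 2 * exp (- / 2 * t))).
    + intros t _; auto_derive; auto; field.
    + intros t _; apply (ex_derive_continuous (fun u => exp (- / 2 * u)) t); auto_derive; auto.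
    + replace (Finite 0) with (Rbar_mult (-2) 0) by (simpl; f_equal; ring).
      apply (is_lim_scal_l (fun t => exp (- / 2 * t))), is_lim_exp_neg; lra. }
destruct Hex as [l Hl]; replace (Gamma s) with l; [exact Hl|].
unfold Gamma; symmetry; apply improper_integral_RInt_gen.
eapply improper_integral_ext; [|exact Hl].
intros t Ht; simpl; now rewrite pow0_pos.
Qed.

Lemma Gamma_pos s : 1 <= s -> 0 < Gamma s.
Proof.
intros Hs; destruct (improper_integral_pow0 s Hs) as [Hex Hlim].
assert (Hpos : forall t, 0 < t -> 0 < pow0 (s - 1) t * exp (- t)).
{ intros t Ht; rewrite pow0_pos by auto; apply Rmult_lt_0_compat; apply exp_pos. }
apply Rlt_le_trans with (RInt (fun t => pow0 (s - 1) t * exp (- t)) 0 1).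
- apply RInt_gt_0; [lra | intros; apply Hpos; lra |].
  intros t _; apply continuous_pow0_exp; lra.
- apply (is_lim_le_loc (fun _ => RInt (fun t => pow0 (s - 1) t * exp (- t)) 0 1)
    (fun T => RInt (fun t => pow0 (s - 1) t * exp (- t)) 0 T) p_infty
    (RInt (fun t => pow0 (s - 1) t * exp (- t)) 0 1) (Gamma s)); auto.
  + exists 1; intros T HT; apply RInt_0_mono; auto; [|lra].
    intros t Ht; left; auto.
  + apply is_lim_const.
Qed.

Lemma Gamma_1 : Gamma 1 = 1.
Proof.
unfold Gamma; apply improper_integral_RInt_gen.
apply (improper_integral_ext (fun t => exp (- t))).
{ intros t Ht; replace (1 - 1) with 0 by ring; rewrite Rpower_O; lra. }
replace 1 with (0 - - exp (- 0)) by (rewrite Ropp_0, exp_0; ring).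
apply (improper_integral_derive (fun t => - exp (- t))).
- intros t _; auto_derive; auto; ring.
- intros t _; apply (ex_derive_continuous (fun u => exp (- u)) t); auto_derive; auto.
- apply (is_lim_ext (fun t => - 1 * exp (- (1) * t))).
  { intros t; replace (- (1) * t) with (- t) by ring; ring. }
  replace (Finite 0) with (Rbar_mult (-1) 0) by (simpl; f_equal; ring).
  apply (is_lim_scal_l (fun t => exp (- (1) * t))), is_lim_exp_neg; lra.
Qed.

(** Integration by parts: [- t^s exp (- t)] vanishes at infinity and, since [s >= 1], also at 0, so
    its derivative integrates to 0. *)
Lemma Gamma_succ s : 1 <= s -> Gamma (s + 1) = s * Gamma s.
Proof.
intros Hs.
assert (HF : improper_integral
  (fun t => pow0 s t * exp (- t) + - s * (pow0 (s - 1) t * exp (- t)))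
  (0 - - (pow0 s 0 * exp (- 0)))).
{ apply (improper_integral_derive_open (fun t => - (pow0 s t * exp (- t)))).
  + intros t Ht.
    replace (pow0 s t * exp (- t) + - s * (pow0 (s - 1) t * exp (- t))) with
      (- (s * pow0 (s - 1) t * exp (- t) + pow0 s t * (- exp (- t)))) by ring.
    apply (is_derive_opp (fun u => pow0 s u * exp (- u)) t).
    apply (is_derive_mult (pow0 s) (fun u => exp (- u)) t).
    * apply is_derive_pow0, Ht.
    * auto_derive; auto; ring.
    * intros; apply Rmult_comm.
  + intros t _; apply (continuous_opp (fun u => pow0 s u * exp (- u))), continuous_pow0_exp; lra.
  + intros t; apply (continuous_plus (fun u => pow0 s u * exp (- u))
                       (fun u => - s * (pow0 (s - 1) u * exp (- u)))).
    * apply continuous_pow0_exp; lra.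
    * apply (continuous_scal_r (- s) (fun u => pow0 (s - 1) u * exp (- u))).
      apply continuous_pow0_exp; lra.
  + replace (Finite 0) with (Rbar_opp 0) by (simpl; f_equal; ring).
    apply (is_lim_opp (fun u => pow0 s u * exp (- u))), is_lim_pow0_exp; lra. }
replace (pow0 s 0) with 0 in HF by
  (unfold pow0; destruct (Rle_dec 0 0); destruct (Req_EM_T s 0); lra).
pose proof (improper_integral_pow0 (s + 1) ltac:(lra)) as H1.
replace (s + 1 - 1) with s in H1 by ring.
pose proof (improper_integral_plus _ _ _ _ H1
  (improper_integral_scal _ (- s) _ (improper_integral_pow0 s Hs))) as H2.
pose proof (improper_integral_unique _ _ _ HF H2); lra.
Qed.

(** * Moments of the Baskakov kernels *)

(** After the substitution [u = c t] this is the integrand of the beta integral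
    [B(k + 1, s - k - 1)] over the half-line. *)
Definition beta_kernel (c : R) (k : nat) (s t : R) : R :=
  (c * t) ^ k / Rpower (1 + c * t) s.

Lemma is_lim_Rpower_neg c a : 0 < c -> 0 < a ->
  is_lim (fun t => / Rpower (1 + c * t) a) p_infty 0.
Proof.
intros Hc Ha; apply is_lim_spec; intros eps; pose proof (cond_pos eps) as He.
exists (Rpower (/ eps) (/ a) / c); intros t Ht.
pose proof (exp_pos (/ a * ln (/ eps))) as H0; change (0 < Rpower (/ eps) (/ a)) in H0.
apply Rmult_lt_compat_l with (r := c) in Ht; auto.
replace (c * (Rpower (/ eps) (/ a) / c)) with (Rpower (/ eps) (/ a)) in Ht by (field; lra).
assert (Hp : / eps < Rpower (1 + c * t) a).
{ replace (/ eps) with (Rpower (Rpower (/ eps) (/ a)) a).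
  - apply Rlt_Rpower_l; lra.
  - rewrite Rpower_mult, Rinv_l, Rpower_1; auto; [|lra].
    now apply Rinv_0_lt_compat. }
rewrite Rminus_0_r, Rabs_pos_eq.
- rewrite <- (Rinv_inv eps); apply Rinv_lt_contravar; auto.
  apply Rmult_lt_0_compat; [now apply Rinv_0_lt_compat | apply exp_pos].
- left; apply Rinv_0_lt_compat, exp_pos.
Qed.

Lemma continuous_beta_kernel c k s t : 0 < c -> 0 <= t -> continuous (beta_kernel c k s) t.
Proof.
intros Hc Ht; apply (ex_derive_continuous (beta_kernel c k s) t).
assert (0 <= c * t) by (apply Rmult_le_pos; lra).
unfold beta_kernel, Rpower; auto_derive; repeat split; try lra.
pose proof (exp_pos (s * ln (1 + c * t))); lra.
Qed.

Lemma improper_integral_beta_kernel_0 c s : 0 < c -> 1 < s ->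
  improper_integral (beta_kernel c 0 s) (/ (c * (s - 1))).
Proof.
intros Hc Hs.
replace (/ (c * (s - 1))) with
  (0 - - / (c * (s - 1)) * / Rpower (1 + c * 0) (s - 1)).
2: { rewrite Rmult_0_r, Rplus_0_r; unfold Rpower.
     rewrite ln_1, Rmult_0_r, exp_0; field; lra. }
apply (improper_integral_derive
  (fun t => - / (c * (s - 1)) * / Rpower (1 + c * t) (s - 1))).
- intros t Ht; assert (0 <= c * t) by (apply Rmult_le_pos; lra).
  pose proof (exp_pos (s * ln (1 + c * t))).
  unfold beta_kernel.
  replace (Rpower (1 + c * t) s) with (Rpower (1 + c * t) (s - 1) * (1 + c * t)).
  2: { rewrite <- (Rpower_1 (1 + c * t)) at 2 by lra.
       rewrite <- Rpower_plus; f_equal; ring. }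
  unfold Rpower; auto_derive.
  + repeat split; try lra; pose proof (exp_pos ((s - 1) * ln (1 + c * t))); lra.
  + simpl; field; repeat split; try lra.
    pose proof (exp_pos ((s - 1) * ln (1 + c * t))); lra.
- intros; now apply continuous_beta_kernel.
- replace (Finite 0) with (Rbar_mult (- / (c * (s - 1))) 0) by (simpl; f_equal; ring).
  apply (is_lim_scal_l (fun t => / Rpower (1 + c * t) (s - 1))), is_lim_Rpower_neg; lra.
Qed.

(* Integrates the derivative of [(c t)^(k+1) (1 + c t)^(1 - s)], which vanishes at [0] and
   at infinity; [s] stays fixed, so no ratio of the form [Gamma s / Gamma (s + 1)] appears. *)
Lemma improper_integral_beta_kernel_S c k s l : 0 < c -> INR k + 2 < s ->
  improper_integral (beta_kernel c k s) l ->
  improper_integral (beta_kernel c (S k) s) ((INR k + 1) / (s - INR k - 2) * l).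
Proof.
intros Hc Hs Hl.
assert (HF : improper_integral
  (fun t => c * ((INR k + 1) * beta_kernel c k s t
                 - (s - INR k - 2) * beta_kernel c (S k) s t))
  (0 - (c * 0) ^ S k * (1 + c * 0) / Rpower (1 + c * 0) s)).
{ apply (improper_integral_derive
    (fun t => (c * t) ^ S k * (1 + c * t) / Rpower (1 + c * t) s)).
  - intros t Ht; assert (0 <= c * t) by (apply Rmult_le_pos; lra).
    pose proof (exp_pos (s * ln (1 + c * t))).
    unfold beta_kernel, Rpower; auto_derive; [repeat split; lra|].
    replace (match k with O => 1 | S _ => INR k + 1 end) with (INR k + 1) by (destruct k; simpl; ring).
    simpl; field; repeat split; lra.
  - intros t Ht.
    apply (continuous_scal_r c (fun t => (INR k + 1) * beta_kernel c k s t
                 - (s - INR k - 2) * beta_kernel c (S k) s t)).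
    apply (continuous_minus (fun t => (INR k + 1) * beta_kernel c k s t)
      (fun t => (s - INR k - 2) * beta_kernel c (S k) s t)).
    + apply (continuous_scal_r (INR k + 1) (beta_kernel c k s)).
      now apply continuous_beta_kernel.
    + apply (continuous_scal_r (s - INR k - 2) (beta_kernel c (S k) s)).
      now apply continuous_beta_kernel.
  (* Bounding [c t] by [1 + c t] squeezes the boundary term under [(1 + c t)^(k + 2 - s)], which
     tends to 0 because [k + 2 < s]. *)
  - apply (is_lim_le_le_loc (fun _ => 0) (fun t => / Rpower (1 + c * t) (s - INR (S (S k))))).
    + exists 0; intros t Ht; assert (0 < c * t) by (apply Rmult_lt_0_compat; lra).
      assert (HE : / Rpower (1 + c * t) (s - INR (S (S k)))
        = (1 + c * t) ^ S k * (1 + c * t) / Rpower (1 + c * t) s).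
      { rewrite <- Rpower_Ropp.
        replace (- (s - INR (S (S k)))) with (INR (S (S k)) + - s) by ring.
        rewrite Rpower_plus, Rpower_Ropp, Rpower_pow by lra; simpl; unfold Rdiv; ring. }
      rewrite HE.
      assert (0 < / Rpower (1 + c * t) s) by apply Rinv_0_lt_compat, exp_pos.
      assert (0 <= (c * t) ^ S k <= (1 + c * t) ^ S k).
      { split; [apply pow_le; lra | apply pow_incr; lra]. }
      unfold Rdiv; split.
      * apply Rmult_le_pos; [apply Rmult_le_pos|]; lra.
      * apply Rmult_le_compat_r; [lra | apply Rmult_le_compat_r; lra].
    + apply is_lim_const.
    + apply is_lim_Rpower_neg; auto; rewrite !S_INR; lra. }
replace (0 - _) with 0 in HF by (simpl; unfold Rdiv; ring).
(* Solve the formula for the derivative for the kernel of index [S k]; the derivative itself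
   integrates to 0. *)
apply (improper_integral_ext
  (fun t => (INR k + 1) / (s - INR k - 2) * beta_kernel c k s t + - / (c * (s - INR k - 2)) *
     (c * ((INR k + 1) * beta_kernel c k s t
                 - (s - INR k - 2) * beta_kernel c (S k) s t)))).
- intros t Ht; field; lra.
- replace ((INR k + 1) / (s - INR k - 2) * l) with
    ((INR k + 1) / (s - INR k - 2) * l + - / (c * (s - INR k - 2)) * 0) by ring.
  apply improper_integral_plus; apply improper_integral_scal; auto.
Qed.

(** Induction on [k] at fixed [s], with [Gamma_succ] used on both factors of the numerator. The
    bound [INR k + 2 <= s] keeps all arguments of [Gamma] at least 1. *)
Lemma improper_integral_beta_kernel c k s : 0 < c -> INR k + 2 <= s ->
  improper_integral (beta_kernel c k s)
    (Gamma (INR k + 1) * Gamma (s - INR k - 1) / (c * Gamma s)).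
Proof.
intros Hc; induction k as [|k IH]; intros Hs.
- simpl in *; rewrite Rplus_0_l, Gamma_1, Rminus_0_r.
  pose proof (Gamma_succ (s - 1) ltac:(lra)) as HG.
  replace (s - 1 + 1) with s in HG by ring.
  pose proof (Gamma_pos (s - 1) ltac:(lra)).
  rewrite HG.
  replace (1 * Gamma (s - 1) / (c * ((s - 1) * Gamma (s - 1)))) with (/ (c * (s - 1))).
  + apply improper_integral_beta_kernel_0; lra.
  + field; lra.
- rewrite S_INR in *.
  pose proof (pos_INR k).
  pose proof (Gamma_succ (INR k + 1) ltac:(lra)) as H1.
  pose proof (Gamma_succ (s - INR k - 2) ltac:(lra)) as H2.
  replace (s - INR k - 2 + 1) with (s - INR k - 1) in H2 by ring.
  replace (s - (INR k + 1) - 1) with (s - INR k - 2) by ring.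
  specialize (IH ltac:(lra)).
  pose proof (improper_integral_beta_kernel_S c k s _ Hc ltac:(lra) IH) as HS.
  rewrite H1; rewrite H2 in HS.
  replace ((INR k + 1) * Gamma (INR k + 1) * Gamma (s - INR k - 2) / (c * Gamma s)) with
   ((INR k + 1) / (s - INR k - 2) *
          (Gamma (INR k + 1) * ((s - INR k - 2) * Gamma (s - INR k - 2)) / (c * Gamma s)));
    [exact HS|].
  pose proof (Gamma_pos s ltac:(lra)); field; lra.
Qed.

(** The prefactor of the operator is moved into the kernel, which becomes a probability density on
    the half-line. The index is [k = v - 1]. *)
Definition scaled_kernel (n : nat) (c : R) (k : nat) (t : R) : R :=
  (INR n - c) / c * p_kernel n (S k) c t.

Definition scaled_kernel_const (n : nat) (c : R) (k : nat) : R :=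
  c * Gamma (INR n / c + INR k) / (Gamma (INR k + 1) * Gamma (INR n / c - 1)).

Lemma scaled_kernel_const_pos n c k :
  0 < c -> 3 * c < INR n -> 0 < scaled_kernel_const n c k.
Proof.
intros Hc Hn; assert (H3 : 3 < INR n / c) by (apply Rlt_div_r; lra).
pose proof (pos_INR k).
pose proof (Gamma_pos (INR n / c - 1) ltac:(lra)).
pose proof (Gamma_pos (INR k + 1) ltac:(lra)).
pose proof (Gamma_pos (INR n / c + INR k) ltac:(lra)).
apply Rdiv_lt_0_compat; apply Rmult_lt_0_compat; lra.
Qed.

(** The identity [Gamma (n / c) = (n / c - 1) Gamma (n / c - 1)] absorbs the prefactor
    [(n - c) / c]. *)
Lemma scaled_kernelE n c k t : 0 < c -> 3 * c < INR n ->
  scaled_kernel n c k t =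
  scaled_kernel_const n c k * beta_kernel c k (INR n / c + INR k) t.
Proof.
intros Hc Hn; assert (H3 : 3 < INR n / c) by (apply Rlt_div_r; lra).
pose proof (pos_INR k).
pose proof (Gamma_succ (INR n / c - 1) ltac:(lra)) as HG.
replace (INR n / c - 1 + 1) with (INR n / c) in HG by ring.
unfold scaled_kernel, scaled_kernel_const, p_kernel, beta_kernel.
rewrite HG, S_INR; replace (S k - 1)%nat with k by lia.
replace (INR n / c + (INR k + 1) - 1) with (INR n / c + INR k) by ring.
pose proof (Gamma_pos (INR n / c - 1) ltac:(lra)).
pose proof (Gamma_pos (INR k + 1) ltac:(lra)).
pose proof (exp_pos ((INR n / c + INR k) * ln (1 + c * t))); unfold Rpower.
field; repeat split; try lra.
Qed.

Lemma scaled_kernel_pos n c k t : 0 < c -> 3 * c < INR n -> 0 < t ->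
  0 <= scaled_kernel n c k t.
Proof.
intros Hc Hn Ht; rewrite scaled_kernelE by auto.
pose proof (scaled_kernel_const_pos n c k Hc Hn).
unfold beta_kernel; apply Rmult_le_pos; [lra|].
apply Rmult_le_pos; [apply pow_le, Rmult_le_pos; lra |].
left; apply Rinv_0_lt_compat, exp_pos.
Qed.

Lemma continuous_scaled_kernel n c k t : 0 < c -> 3 * c < INR n -> 0 <= t ->
  continuous (scaled_kernel n c k) t.
Proof.
intros Hc Hn Ht.
apply (continuous_ext (fun t =>
  scaled_kernel_const n c k * beta_kernel c k (INR n / c + INR k) t)).
- intros u; symmetry; now apply scaled_kernelE.
- apply (continuous_scal_r (scaled_kernel_const n c k)
    (beta_kernel c k (INR n / c + INR k))).
  now apply continuous_beta_kernel.
Qed.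

(** Multiplying by [t] raises the index of the beta kernel by one and divides by [c], so each moment
    follows from the previous one by [improper_integral_beta_kernel_S]. The second use of that lemma
    is where [3 c < n] is needed. *)
Lemma scaled_kernel_moments n c k : 0 < c -> 3 * c < INR n ->
  improper_integral (scaled_kernel n c k) 1 /\
  improper_integral (fun t => scaled_kernel n c k t * t) (INR (S k) / (INR n - 2 * c)) /\
  improper_integral (fun t => scaled_kernel n c k t * t ^ 2)
    (INR (S k) * INR (S (S k)) / ((INR n - 2 * c) * (INR n - 3 * c))).
Proof.
intros Hc Hn; assert (H3 : 3 < INR n / c) by (apply Rlt_div_r; lra).
pose proof (pos_INR k).
pose proof (Gamma_pos (INR n / c - 1) ltac:(lra)).
pose proof (Gamma_pos (INR k + 1) ltac:(lra)).
pose proof (Gamma_pos (INR n / c + INR k) ltac:(lra)).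
pose proof (scaled_kernel_const_pos n c k Hc Hn) as HA.
assert (Hbase : improper_integral (beta_kernel c k (INR n / c + INR k))
               (/ scaled_kernel_const n c k)).
{ replace (/ scaled_kernel_const n c k) with
    (Gamma (INR k + 1) * Gamma (INR n / c + INR k - INR k - 1) /
       (c * Gamma (INR n / c + INR k))).
  - apply improper_integral_beta_kernel; lra.
  - replace (INR n / c + INR k - INR k - 1) with (INR n / c - 1) by ring.
    unfold scaled_kernel_const; field; repeat split; lra. }
pose proof (improper_integral_beta_kernel_S c k (INR n / c + INR k) _ Hc ltac:(lra) Hbase) as H1'.
pose proof (improper_integral_beta_kernel_S c (S k) (INR n / c + INR k) _ Hc
  ltac:(rewrite S_INR; lra) H1') as H2'.
rewrite !S_INR in *.
assert (INR n / c * c = INR n) by (field; lra).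
assert (Hx : INR n / c + INR k - INR k - 2 = (INR n - 2 * c) / c) by (field; lra).
assert (Hy : INR n / c + INR k - (INR k + 1) - 2 = (INR n - 3 * c) / c) by (field; lra).
rewrite Hx in *; rewrite Hy in *.
split; [|split].
- apply (improper_integral_ext
    (fun t => scaled_kernel_const n c k * beta_kernel c k (INR n / c + INR k) t)).
  { intros; symmetry; now apply scaled_kernelE. }
  rewrite <- (Rinv_r (scaled_kernel_const n c k)) by lra.
  now apply improper_integral_scal.
- apply (improper_integral_ext
    (fun t => scaled_kernel_const n c k / c * beta_kernel c (S k) (INR n / c + INR k) t)).
  { intros; rewrite scaled_kernelE by auto; unfold beta_kernel; simpl.
    pose proof (exp_pos ((INR n / c + INR k) * ln (1 + c * t))); unfold Rpower.
    field; lra. }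
  match goal with |- improper_integral _ ?x => replace x with
    (scaled_kernel_const n c k / c *
      ((INR k + 1) / ((INR n - 2 * c) / c) * / scaled_kernel_const n c k))
      by (field; lra) end.
  now apply improper_integral_scal.
- apply (improper_integral_ext
    (fun t => scaled_kernel_const n c k / c ^ 2 *
       beta_kernel c (S (S k)) (INR n / c + INR k) t)).
  { intros; rewrite scaled_kernelE by auto; unfold beta_kernel; simpl.
    pose proof (exp_pos ((INR n / c + INR k) * ln (1 + c * t))); unfold Rpower.
    field; lra. }
  match goal with |- improper_integral _ ?x => replace x with
    (scaled_kernel_const n c k / c ^ 2 *
      ((INR k + 1 + 1) / ((INR n - 3 * c) / c) *
      ((INR k + 1) / ((INR n - 2 * c) / c) * / scaled_kernel_const n c k)))
      by (field; lra) end.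
  now apply improper_integral_scal.
Qed.

(** * Moments of the Jain weights *)

Lemma sum_n_S (a : nat -> R) m : sum_n a (S m) = sum_n a m + a (S m).
Proof. exact (sum_Sn a m). Qed.

Lemma sum_n_0 (a : nat -> R) : sum_n a 0 = a 0%nat.
Proof. exact (sum_O a). Qed.

Lemma nonneg_of_derive (g dg : R -> R) :
  (forall x, 0 <= x -> is_derive g x (dg x)) -> (forall x, 0 <= x -> 0 <= dg x) ->
  0 <= g 0 -> forall y, 0 <= y -> 0 <= g y.
Proof.
intros Hg Hdg H0 y Hy.
destruct (MVT_gen g 0 y dg) as [z [Hz HE]].
- rewrite Rmin_left by lra; intros x Hx; apply Hg; lra.
- rewrite Rmin_left by lra; intros x Hx; apply continuity_pt_filterlim.
  apply (ex_derive_continuous g x); eexists; apply Hg; lra.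
- rewrite Rmin_left in Hz by lra; specialize (Hdg z (proj1 Hz)); nra.
Qed.

(* For [v = 0] the paper's formula [y * y ^ (-1) * exp (- y)] is [exp (- y)], whereas
   [omega b 0 y] has the truncated exponent [0 - 1 = 0]. *)
Definition jain (b : R) (v : nat) (y : R) : R :=
  match v with O => exp (- y) | S _ => omega b v y end.

Lemma jain_SE b k y : jain b (S k) y =
  y * (y + INR (S k) * b) ^ k * exp (- (y + INR (S k) * b)) / INR (fact (S k)).
Proof. unfold jain, omega; replace (S k - 1)%nat with k by lia; reflexivity. Qed.

Lemma jain_pos b v y : 0 <= b -> 0 <= y -> 0 <= jain b v y.
Proof.
intros Hb Hy; destruct v as [|k]; [left; apply exp_pos|]; rewrite jain_SE.
pose proof (pos_INR (S k)).
apply Rmult_le_pos; [|left; apply Rinv_0_lt_compat, INR_fact_lt_0].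
apply Rmult_le_pos; [|left; apply exp_pos].
apply Rmult_le_pos; [lra|]; apply pow_le; nra.
Qed.

Lemma fact_S_INR k : INR (fact (S k)) = (INR k + 1) * INR (fact k).
Proof. rewrite <- S_INR, <- mult_INR; reflexivity. Qed.

(** Differentiating the exponential returns the weight with a minus sign. The product rule on the
    polynomial factor lowers the index, and [y + (k + 1) b = (y + b) + k b] identifies the result as
    a weight at [y + b]. *)
Lemma is_derive_jain b k y : 
  is_derive (jain b (S k)) y (jain b k (y + b) - jain b (S k) y).
Proof.
apply (is_derive_ext (fun y => y * (y + INR (S k) * b) ^ k *
  exp (- (y + INR (S k) * b)) / INR (fact (S k)))).
{ intros; symmetry; apply jain_SE. }
rewrite jain_SE; pose proof (INR_fact_lt_0 k); pose proof (pos_INR k).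
destruct k as [|j].
- simpl; auto_derive; auto; simpl.
  replace (- (y + b)) with (- (y + 1 * b)) by ring; field.
- rewrite jain_SE, !(fact_S_INR (S j)), !S_INR in *.
  generalize dependent (INR (fact (S j))); intros F HF; auto_derive; auto.
  replace (y + b + (INR j + 1) * b) with (y + (INR j + 1 + 1) * b) by ring.
  replace (match j with O => 1 | S _ => INR j + 1 end) with (INR j + 1)
    by (destruct j; simpl; ring).
  simpl pow; field; lra.
Qed.

Lemma is_derive_sum_jain b m y :
  is_derive (fun y => sum_n (fun v => jain b v y) (S m)) y
    (sum_n (fun v => jain b v (y + b)) m - sum_n (fun v => jain b v y) (S m)).
Proof.
induction m as [|m IH].
- apply (is_derive_ext (fun y => exp (- y) + jain b 1 y)).
  { intros t; rewrite sum_n_S, sum_n_0; reflexivity. }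
  rewrite sum_n_S, !sum_n_0.
  replace (jain b 0 (y + b) - (jain b 0 y + jain b 1 y)) with
    (- exp (- y) + (jain b 0 (y + b) - jain b 1 y)) by (simpl; ring).
  apply (is_derive_plus (fun y => exp (- y)) (jain b 1) y).
  + auto_derive; auto; ring.
  + apply is_derive_jain.
- apply (is_derive_ext (fun y => sum_n (fun v => jain b v y) (S m) + jain b (S (S m)) y)).
  { intros t; rewrite (sum_n_S _ (S m)); reflexivity. }
  rewrite (sum_n_S _ (S m)), (sum_n_S (fun v => jain b v (y + b)) m).
  match goal with |- is_derive _ _ (?a + ?b - (?c + ?d)) =>
    replace (a + b - (c + d)) with ((a - c) + (b - d)) by ring end.
  apply (is_derive_plus (fun y => sum_n (fun v => jain b v y) (S m)) (jain b (S (S m))) y).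
  + exact IH.
  + apply is_derive_jain.
Qed.

Lemma sum_jain_at_0 b m : (sum_n (fun v => jain b v 0) m : R) = 1.
Proof.
induction m as [|m IH].
- rewrite sum_n_0; simpl; rewrite Ropp_0; apply exp_0.
- rewrite sum_n_S, IH, jain_SE; unfold Rdiv; ring.
Qed.

(** This makes the ratio [exp (/ 2) / 2] of the geometric bound on the defect smaller than 1;
    [exp 1 <= 3 < 4] is enough. *)
Lemma exp_half_lt_2 : exp (/ 2) < 2.
Proof.
pose proof exp_le_3 as H3; pose proof (exp_pos (/ 2)).
replace 1 with (/ 2 + / 2) in H3 by field; rewrite exp_plus in H3; nra.
Qed.

(* The defect [1 - S_m] satisfies
   [(exp y * (1 - S_(m+1) y))' = exp y * (1 - S_m (y + b))], and [exp y * q ^ m] is a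
   supersolution of this recursion as soon as [exp b <= 2 * q]. *)
Lemma sum_jain_defect b m y : 0 <= b <= / 2 -> 0 <= y ->
  0 <= 1 - sum_n (fun v => jain b v y) m <= exp y * (exp (/ 2) / 2) ^ m.
Proof.
intros Hb; revert y; induction m as [|m IH]; intros y Hy.
- rewrite sum_n_0; simpl.
  pose proof (exp_pos (- y)); pose proof (exp_ineq1_le y).
  assert (exp (- y) <= 1).
  { rewrite exp_Ropp; rewrite <- Rinv_1; apply Rinv_le_contravar; lra. }
  lra.
- pose (T := fun y => 1 - sum_n (fun v => jain b v y) (S m)).
  assert (HT : forall x, is_derive (fun y => exp y * T y) x
            (exp x * (1 - sum_n (fun v => jain b v (x + b)) m))).
  { intros x.
    replace (exp x * (1 - sum_n (fun v => jain b v (x + b)) m)) with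
      (exp x * T x + exp x * (0 - (sum_n (fun v => jain b v (x + b)) m -
         sum_n (fun v => jain b v x) (S m)))) by (unfold T; ring).
    apply (is_derive_mult exp T x).
    - apply is_derive_exp.
    - apply (is_derive_minus (fun _ => 1) (fun y => sum_n (fun v => jain b v y) (S m)) x).
      + apply (is_derive_const 1 x).
      + apply is_derive_sum_jain.
    - intros; apply Rmult_comm. }
  assert (HT0 : T 0 = 0) by (unfold T; rewrite sum_jain_at_0; ring).
  pose proof exp_half_lt_2; set (q := exp (/ 2) / 2) in *.
  assert (Hq : 0 < q) by (pose proof (exp_pos (/ 2)); unfold q; lra).
  pose proof (pow_lt q m Hq) as Hqm.
  change (0 <= T y <= exp y * q ^ S m).
  assert (Hlow : 0 <= exp y * T y).
  { apply (nonneg_of_derive (fun y => exp y * T y)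
      (fun x => exp x * (1 - sum_n (fun v => jain b v (x + b)) m))); auto.
    - intros x Hx; apply Rmult_le_pos; [left; apply exp_pos | apply IH; lra].
    - rewrite HT0; lra. }
  (* In the derivative, [2 q^(m+1) exp (2 x)] competes with a term that the induction hypothesis at
     [x + b] bounds by [exp b q^m exp (2 x)]; here [exp b <= 2 q] decides. *)
  assert (Hup : 0 <= q ^ S m * exp (2 * y) - exp y * T y).
  { apply (nonneg_of_derive (fun y => q ^ S m * exp (2 * y) - exp y * T y)
      (fun x => q ^ S m * (2 * exp (2 * x)) -
         exp x * (1 - sum_n (fun v => jain b v (x + b)) m))); auto.
    - intros x Hx.
      apply (is_derive_minus (fun y => q ^ S m * exp (2 * y)) (fun y => exp y * T y) x).
      + generalize (q ^ S m); intros Q; auto_derive; auto; ring.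
      + apply HT.
    - intros x Hx; destruct (IH (x + b) ltac:(lra)) as [_ IHu].
      pose proof (exp_pos x) as Hex.
      assert (Heb : exp b <= 2 * q).
      { unfold q; destruct (proj2 Hb) as [Hlt| ->]; [apply exp_increasing in Hlt|]; lra. }
      replace (2 * x) with (x + x) by ring; rewrite exp_plus in *; simpl.
      apply Rmult_le_compat_l with (r := exp x) in IHu; [|lra].
      assert (exp x * exp b * q ^ m <= exp x * (2 * q) * q ^ m).
      { apply Rmult_le_compat_r; [lra|]; apply Rmult_le_compat_l; lra. }
      nra.
    - rewrite HT0, Rmult_0_r, exp_0.
      assert (0 < q ^ S m) by (apply pow_lt; lra); lra. }
  pose proof (exp_pos y).
  replace (2 * y) with (y + y) in Hup by ring; rewrite exp_plus in Hup.
  split; [nra|].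
  apply Rmult_le_reg_l with (exp y); [auto|]; nra.
Qed.

Lemma is_series_jain b y : 0 <= b <= / 2 -> 0 <= y -> is_series (fun v => jain b v y) 1.
Proof.
intros Hb Hy.
change (is_lim_seq (sum_n (fun v => jain b v y)) 1).
pose proof exp_half_lt_2; pose proof (exp_pos (/ 2)).
apply (is_lim_seq_le_le (fun m => 1 - exp y * (exp (/ 2) / 2) ^ m) _ (fun _ => 1)).
- intros m; pose proof (sum_jain_defect b m y Hb Hy); lra.
- replace (Finite 1) with (Finite (1 - exp y * 0)) by (f_equal; ring).
  apply (is_lim_seq_minus' (fun _ => 1) (fun m => exp y * (exp (/ 2) / 2) ^ m)).
  + apply is_lim_seq_const.
  + apply (is_lim_seq_scal_l (fun m => (exp (/ 2) / 2) ^ m) (exp y) 0).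
    apply is_lim_seq_geom; rewrite Rabs_pos_eq; lra.
- apply is_lim_seq_const.
Qed.

(* The sums of [k * jain b k] and [k ^ 2 * jain b k] reduce to those of these weights, whose
   partial sums satisfy linear recursions between [z] and [z + b]. *)
Definition borel (b : R) (k : nat) (z : R) : R :=
  (z + INR k * b) ^ k * exp (- (z + INR k * b)) / INR (fact k).

Lemma borel_pos b k z : 0 <= b -> 0 <= z -> 0 <= borel b k z.
Proof.
intros Hb Hz; pose proof (pos_INR k).
apply Rmult_le_pos; [|left; apply Rinv_0_lt_compat, INR_fact_lt_0].
apply Rmult_le_pos; [|left; apply exp_pos]; apply pow_le; nra.
Qed.

Lemma mul_jain_borel b k y : INR (S k) * jain b (S k) y = y * borel b k (y + b).
Proof.
rewrite jain_SE, fact_S_INR; unfold borel; rewrite S_INR.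
replace (y + b + INR k * b) with (y + (INR k + 1) * b) by ring.
pose proof (INR_fact_lt_0 k); pose proof (pos_INR k); field; lra.
Qed.

(** One factor [z + (k + 1) b] of the power is split: its part [z] gives the Jain weight, its part
    [(k + 1) b] cancels against the factorial. *)
Lemma borel_S b k z : borel b (S k) z = jain b (S k) z + b * borel b k (z + b).
Proof.
rewrite jain_SE, fact_S_INR; unfold borel; rewrite fact_S_INR, S_INR.
replace (z + b + INR k * b) with (z + (INR k + 1) * b) by ring.
pose proof (INR_fact_lt_0 k); pose proof (pos_INR k); simpl; field; lra.
Qed.

(** Here [k + 1] cancels against the factorial, and one factor of the power is written
    [(z + b) + k b]. *)
Lemma mul_borel_S b k z :
  INR (S k) * borel b (S k) z = (z + b) * borel b k (z + b) + b * (INR k * borel b k (z + b)).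
Proof.
unfold borel; rewrite fact_S_INR, S_INR.
replace (z + b + INR k * b) with (z + (INR k + 1) * b) by ring.
pose proof (INR_fact_lt_0 k); pose proof (pos_INR k); simpl; field; lra.
Qed.

Lemma borel_0 b z : borel b 0 z = exp (- z).
Proof. unfold borel; simpl; rewrite Rmult_0_l, Rplus_0_r; field. Qed.

Lemma sum_borel_S b m z : (sum_n (fun k => borel b k z) (S m) : R) =
  sum_n (fun v => jain b v z) (S m) + b * sum_n (fun k => borel b k (z + b)) m.
Proof.
induction m as [|m IH].
- rewrite !sum_n_S, !sum_n_0, borel_S, borel_0; simpl; ring.
- rewrite sum_n_S, IH, borel_S, (sum_n_S _ (S m)), (sum_n_S (fun k => borel b k (z + b)) m).
  ring.
Qed.

Lemma sum_mul_borel_S b m z : (sum_n (fun k => INR k * borel b k z) (S m) : R) =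
  (z + b) * sum_n (fun k => borel b k (z + b)) m +
  b * sum_n (fun k => INR k * borel b k (z + b)) m.
Proof.
induction m as [|m IH].
- rewrite sum_n_S, !sum_n_0, mul_borel_S; simpl; ring.
- rewrite sum_n_S, IH, mul_borel_S, !(sum_n_S _ m); ring.
Qed.

(** The constant [mu = 1 / (1 - b)] enters as the fixed point of [u = 1 + b u], the form in which
    [sum_borel_S] reproduces the upper bound. The lower bound holds term by term by [borel_S]. *)
Lemma sum_borel_bounds b mu m z : 0 <= b <= / 2 -> 1 + b * mu = mu -> 0 <= z ->
  sum_n (fun v => jain b v z) m <= sum_n (fun k => borel b k z) m <= mu.
Proof.
intros Hb Hmu Hz; split.
- apply sum_n_m_le; intros [|k].
  + rewrite borel_0; apply Rle_refl.
  + rewrite borel_S.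
    pose proof (borel_pos b k (z + b) ltac:(lra) ltac:(lra)); nra.
- revert z Hz; induction m as [|m IH]; intros z Hz.
  + rewrite sum_n_0, borel_0.
    pose proof (sum_jain_defect b 0 z Hb Hz) as H; rewrite sum_n_0 in H; simpl in H; nra.
  + rewrite sum_borel_S; specialize (IH (z + b) ltac:(lra)).
    pose proof (sum_jain_defect b (S m) z Hb Hz); nra.
Qed.

(** The constant 4 closes the induction: from [b mu <= 1] and [b <= 1/2], the remainder
    [b mu + (b mu)^2 + 4 b] is at most [1 + 1 + 2]. *)
Lemma sum_mul_borel_le b mu m z : 0 <= b <= / 2 -> 1 + b * mu = mu -> 0 <= z ->
  sum_n (fun k => INR k * borel b k z) m <= mu ^ 2 * z + 4.
Proof.
intros Hb Hmu; revert z; induction m as [|m IH]; intros z Hz.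
- rewrite sum_n_0; simpl; nra.
- rewrite sum_mul_borel_S; specialize (IH (z + b) ltac:(lra)).
  pose proof (sum_borel_bounds b mu m (z + b) Hb Hmu ltac:(lra)) as [_ HR].
  assert (Hbmu : 0 <= b * mu <= 1) by nra.
  apply Rle_trans with ((z + b) * mu + b * (mu ^ 2 * (z + b) + 4)).
  + apply Rplus_le_compat; apply Rmult_le_compat_l; lra.
  + replace ((z + b) * mu + b * (mu ^ 2 * (z + b) + 4)) with
      (z * mu * (1 + b * mu) + b * mu + (b * mu) ^ 2 + 4 * b) by ring.
    rewrite Hmu; nra.
Qed.

Lemma sum_jain_moment_1 b m y : (sum_n (fun v => INR v * jain b v y) (S m) : R) =
  y * sum_n (fun k => borel b k (y + b)) m.
Proof.
induction m as [|m IH].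
- rewrite sum_n_S, !sum_n_0, mul_jain_borel; simpl; ring.
- rewrite sum_n_S, IH, mul_jain_borel, (sum_n_S _ m); ring.
Qed.

(** One factor [v] is consumed by [mul_jain_borel]; the other, equal to [k + 1], splits the sum in
    two. The term [v = 0] vanishes, hence the shift from [S m] to [m]. *)
Lemma sum_jain_moment_2 b m y : (sum_n (fun v => INR v ^ 2 * jain b v y) (S m) : R) =
  y * (sum_n (fun k => INR k * borel b k (y + b)) m + sum_n (fun k => borel b k (y + b)) m).
Proof.
assert (H : forall k, INR (S k) ^ 2 * jain b (S k) y = y * ((INR k + 1) * borel b k (y + b))).
{ intros k; replace (INR (S k) ^ 2 * jain b (S k) y) with
    (INR (S k) * (INR (S k) * jain b (S k) y)) by ring.
  rewrite mul_jain_borel, S_INR; ring. }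
induction m as [|m IH].
- rewrite sum_n_S, !sum_n_0, H; simpl; ring.
- rewrite sum_n_S, IH, H, !(sum_n_S _ m), S_INR; ring.
Qed.

Lemma is_series_nonneg_bounded (a : nat -> R) B :
  (forall k, 0 <= a k) -> (forall m, sum_n a (S m) <= B) ->
  exists l, is_series a l /\ l <= B.
Proof.
intros Ha HB.
assert (Hincr : forall m, sum_n a m <= sum_n a (S m)).
{ intros m; rewrite sum_n_S; specialize (Ha (S m)); lra. }
assert (HB' : forall m, sum_n a m <= B) by (intros m; eapply Rle_trans; eauto).
destruct (ex_finite_lim_seq_incr (sum_n a) B Hincr HB') as [l Hl].
exists l; split; [exact Hl|].
apply (is_lim_seq_le (sum_n a) (fun _ => B) l B); auto; apply is_lim_seq_const.
Qed.

(** The bounds on Borel partial sums pass to the limit. The lower bound on [m1] uses that Borel sums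
    dominate Jain sums, which tend to 1. *)
Lemma jain_moments b mu y : 0 <= b <= / 2 -> 1 + b * mu = mu -> 0 <= y ->
  exists m1 m2,
    is_series (fun v => INR v * jain b v y) m1 /\ y <= m1 <= mu * y /\
    is_series (fun v => INR v ^ 2 * jain b v y) m2 /\ m2 <= y * (mu ^ 2 * y + 8).
Proof.
intros Hb Hmu Hy.
assert (Hmu2 : 1 <= mu <= 2) by nra.
destruct (is_series_nonneg_bounded (fun v => INR v * jain b v y) (mu * y)) as [m1 [Hm1 Hle1]].
{ intros k; apply Rmult_le_pos; [apply pos_INR | apply jain_pos; lra]. }
{ intros m; rewrite sum_jain_moment_1.
  pose proof (sum_borel_bounds b mu m (y + b) Hb Hmu ltac:(lra)); nra. }
destruct (is_series_nonneg_bounded (fun v => INR v ^ 2 * jain b v y) (y * (mu ^ 2 * y + 8)))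
  as [m2 [Hm2 Hle2]].
{ intros k; apply Rmult_le_pos; [apply pow2_ge_0 | apply jain_pos; lra]. }
{ intros m; rewrite sum_jain_moment_2; apply Rmult_le_compat_l; [lra|].
  pose proof (sum_borel_bounds b mu m (y + b) Hb Hmu ltac:(lra)).
  pose proof (sum_mul_borel_le b mu m (y + b) Hb Hmu ltac:(lra)).
  (* Indeed [mu^2 b = mu (mu - 1)]; together with the 4 of [sum_mul_borel_le] and [mu <= 2] this
     gives the constant [2 + 4 + 2 = 8]. *)
  assert (mu ^ 2 * b <= 2) by nra.
  nra. }
exists m1, m2; repeat split; auto.
assert (HL : is_lim_seq (fun m => y * sum_n (fun v => jain b v (y + b)) m) (y * 1)).
{ apply (is_lim_seq_scal_l _ y 1), is_series_jain; lra. }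
rewrite Rmult_1_r in HL.
apply (is_lim_seq_le (fun m => y * sum_n (fun v => jain b v (y + b)) m)
  (fun m => sum_n (fun v => INR v * jain b v y) (S m)) y m1); auto.
- intros m; rewrite sum_jain_moment_1; apply Rmult_le_compat_l; [lra|].
  apply (sum_borel_bounds b mu m (y + b)); auto; lra.
- apply (is_lim_seq_incr_1 (sum_n (fun v => INR v * jain b v y)) m1), Hm1.
Qed.

(** * Korovkin estimate *)

(** Composition with [Rmax 0] turns one-sided continuity at 0 into the two-sided notion required by
    the integration lemmas and by Heine's theorem. *)
Lemma continuous_Rmax_0 (f : R -> R) :
  (forall x, 0 <= x ->
     filterlim f (within (fun t => 0 <= t) (locally x)) (locally (f x))) ->
  forall x, 0 <= x -> continuous (fun t => f (Rmax 0 t)) x.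
Proof.
intros Hf x Hx P HP; rewrite Rmax_right in HP by auto.
destruct (Hf x Hx P HP) as [eps Heps]; exists eps; intros t Ht.
apply Heps; [|apply Rmax_l].
apply Rabs_lt_between' in Ht; apply Rabs_lt_between'.
unfold Rmax; destruct (Rle_dec 0 t); lra.
Qed.

(** The growth bound on [f] gives a dominating function whose integral is known from the moments of
    order 0 and 2. *)
Lemma improper_integral_scaled_kernel n c f M k :
  0 < c -> 3 * c < INR n ->
  (forall x, 0 <= x -> continuous (fun t => f (Rmax 0 t)) x) ->
  (forall x, 0 <= x -> Rabs (f x) <= M * (1 + x ^ 2)) ->
  exists l, improper_integral (fun t => scaled_kernel n c k t * f t) l.
Proof.
intros Hc Hn Hf HM.
destruct (scaled_kernel_moments n c k Hc Hn) as [H0 [_ H2]].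
eapply (improper_integral_dominated _
  (fun t => M * (scaled_kernel n c k t + scaled_kernel n c k t * t ^ 2))).
- intros T HT.
  apply (ex_RInt_ext (fun t => scaled_kernel n c k t * f (Rmax 0 t))).
  + rewrite Rmin_left by lra; intros x Hx; rewrite (Rmax_right 0 x); lra.
  + apply (ex_RInt_continuous (fun t => scaled_kernel n c k t * f (Rmax 0 t))).
    rewrite Rmin_left by lra; intros x Hx.
    apply (continuous_mult (scaled_kernel n c k) (fun t => f (Rmax 0 t))).
    * apply continuous_scaled_kernel; lra.
    * apply Hf; lra.
- intros t Ht; pose proof (scaled_kernel_pos n c k t Hc Hn Ht) as Hp.
  rewrite Rabs_mult, (Rabs_pos_eq (scaled_kernel n c k t)) by auto.
  replace (M * (scaled_kernel n c k t + scaled_kernel n c k t * t ^ 2)) with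
    (scaled_kernel n c k t * (M * (1 + t ^ 2))) by ring.
  apply Rmult_le_compat_l, HM; lra.
- apply improper_integral_scal, improper_integral_plus; eassumption.
Qed.

(* The second moment around [x] of [scaled_kernel n c (v - 1)]; for [v = 0] it is [x ^ 2],
   that of the point mass at [0], which is the term [exp (- n x) * f 0] of the operator. *)
Definition kernel_var (n : nat) (c x : R) (v : nat) : R :=
  x ^ 2 + (INR v ^ 2 + INR v) / ((INR n - 2 * c) * (INR n - 3 * c))
  - 2 * x / (INR n - 2 * c) * INR v.

(** The kernel has mass 1, so [l - f x] is the integral of [f t - f x] against it, and the pointwise
    bound can be integrated. *)
Lemma scaled_kernel_deviation n c f x al K k l :
  0 < c -> 3 * c < INR n ->
  (forall t, 0 <= t -> Rabs (f t - f x) <= al + K * (t - x) ^ 2) ->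
  improper_integral (fun t => scaled_kernel n c k t * f t) l ->
  Rabs (l - f x) <= al + K * kernel_var n c x (S k).
Proof.
intros Hc Hn Hf Hl.
destruct (scaled_kernel_moments n c k Hc Hn) as [H0 [H1 H2]].
assert (HB : improper_integral
  (fun t => scaled_kernel n c k t * (al + K * (t - x) ^ 2))
  (al + K * kernel_var n c x (S k))).
{ apply (improper_integral_ext (fun t =>
    (al + K * x ^ 2) * scaled_kernel n c k t +
     ((- 2 * K * x) * (scaled_kernel n c k t * t) +
      K * (scaled_kernel n c k t * t ^ 2)))).
  { intros; ring. }
  match goal with |- improper_integral _ ?z => replace z with
    ((al + K * x ^ 2) * 1 + ((- 2 * K * x) * (INR (S k) / (INR n - 2 * c)) +
       K * (INR (S k) * INR (S (S k)) / ((INR n - 2 * c) * (INR n - 3 * c))))) end.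
  - apply improper_integral_plus; [|apply improper_integral_plus];
      apply improper_integral_scal; assumption.
  - unfold kernel_var; rewrite (S_INR (S k)); field; lra. }
assert (HD : improper_integral (fun t => scaled_kernel n c k t * (f t - f x)) (l - f x)).
{ apply (improper_integral_ext (fun t =>
    scaled_kernel n c k t * f t + (- f x) * scaled_kernel n c k t)).
  { intros; ring. }
  replace (l - f x) with (l + (- f x) * 1) by ring.
  apply improper_integral_plus; [exact Hl | now apply improper_integral_scal]. }
assert (Hpt : forall t, 0 < t ->
   - (al + K * (t - x) ^ 2) <= f t - f x <= al + K * (t - x) ^ 2).
{ intros t Ht; apply Rabs_le_between, Hf; lra. }
apply Rabs_le_between; split.
- apply Ropp_le_cancel; rewrite Ropp_involutive.
  replace (- (l - f x)) with (- 1 * (l - f x)) by ring.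
  refine (improper_integral_le _ _ _ _ _ (improper_integral_scal _ (- 1) _ HD) HB).
  intros t Ht; simpl.
  pose proof (scaled_kernel_pos n c k t Hc Hn Ht); specialize (Hpt t Ht).
  replace (- 1 * (scaled_kernel n c k t * (f t - f x))) with
    (scaled_kernel n c k t * (- (f t - f x))) by ring.
  apply Rmult_le_compat_l; lra.
- refine (improper_integral_le _ _ _ _ _ HD HB).
  intros t Ht; simpl.
  pose proof (scaled_kernel_pos n c k t Hc Hn Ht); specialize (Hpt t Ht).
  apply Rmult_le_compat_l; lra.
Qed.

Lemma is_series_Rext (a b : nat -> R) (l : R) :
  (forall v, a v = b v) -> is_series a l -> is_series b l.
Proof. apply is_series_ext. Qed.

Lemma is_series_Rplus (a b : nat -> R) (l m : R) :
  is_series a l -> is_series b m -> is_series (fun v => a v + b v) (l + m).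
Proof. apply (is_series_plus a b l m). Qed.

Lemma is_series_Rscal (k : R) (a : nat -> R) (l : R) :
  is_series a l -> is_series (fun v => k * a v) (k * l).
Proof. apply (is_series_scal_l k a l). Qed.

(* An upper bound of [D_op ((t - x) ^ 2, x) / (1 + x ^ 2)]; [n / (n - a)] is written
   [1 + a / (n - a)]. *)
Definition korovkin_rate (n : nat) (c b : R) : R :=
  (/ (1 - b)) ^ 2 * (1 + 2 * c * / (INR n - 2 * c)) * (1 + 3 * c * / (INR n - 3 * c)) - 1
  + 10 * (1 + 2 * c * / (INR n - 2 * c)) * / (INR n - 3 * c).

(** The operator averages, with Jain weights of total mass 1, the kernel integrals and the point
    mass at 0. Hence [al] passes through unchanged and [K] multiplies the second moment around
    [x]. *)
Lemma D_op_deviation n c b f x al K M :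
  0 < c -> 3 * c < INR n -> 0 <= b <= / 2 -> 0 <= x -> 0 <= K ->
  (forall x, 0 <= x -> continuous (fun t => f (Rmax 0 t)) x) ->
  (forall x, 0 <= x -> Rabs (f x) <= M * (1 + x ^ 2)) ->
  (forall t, 0 <= t -> Rabs (f t - f x) <= al + K * (t - x) ^ 2) ->
  Rabs (D_op n c b f x - f x) <= al + K * (korovkin_rate n c b * (1 + x ^ 2)).
Proof.
intros Hc Hn Hb Hx HK Hfc HM Hf.
set (y := INR n * x).
assert (Hy : 0 <= y) by (apply Rmult_le_pos; lra).
set (L k := (INR n - c) / c *
  RInt_gen (fun t => p_kernel n (S k) c t * f t) (at_point 0) (Rbar_locally p_infty)).
assert (HL : forall k, improper_integral (fun t => scaled_kernel n c k t * f t) (L k)).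
{ intros k; destruct (improper_integral_scaled_kernel n c f M k Hc Hn Hfc HM) as [l Hl].
  replace (L k) with l; [exact Hl|]; unfold L.
  rewrite (improper_integral_RInt_gen _ (c / (INR n - c) * l)); [field; lra|].
  apply (improper_integral_ext (fun t => c / (INR n - c) * (scaled_kernel n c k t * f t))).
  - intros t _; unfold scaled_kernel; field; lra.
  - now apply improper_integral_scal. }
(* The value [f 0] becomes the term of index 0, so that a single series over all Jain weights
   represents the operator. *)
set (a v := match v with O => f 0 | S k => L k end).
set (B v := jain b v y * (al + K * kernel_var n c x v)).
set (mu := / (1 - b)).
assert (Hmu : 1 + b * mu = mu) by (unfold mu; field; lra).
destruct (jain_moments b mu y Hb Hmu Hy) as [m1 [m2 [Hm1 [Hm1b [Hm2 Hm2b]]]]].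
pose proof (is_series_jain b y Hb Hy) as Hm0.
assert (HB : is_series B (al + K * (x ^ 2 + (m2 + m1) / ((INR n - 2 * c) * (INR n - 3 * c))
  - 2 * x / (INR n - 2 * c) * m1))).
{ apply (is_series_Rext (fun v => (al + K * x ^ 2) * jain b v y +
    ((K / ((INR n - 2 * c) * (INR n - 3 * c)) - 2 * x * K / (INR n - 2 * c)) *
        (INR v * jain b v y) +
     K / ((INR n - 2 * c) * (INR n - 3 * c)) * (INR v ^ 2 * jain b v y)))).
  { intros v; unfold B, kernel_var; field; lra. }
  replace (al + K * (x ^ 2 + (m2 + m1) / ((INR n - 2 * c) * (INR n - 3 * c))
    - 2 * x / (INR n - 2 * c) * m1)) with ((al + K * x ^ 2) * 1 +
    ((K / ((INR n - 2 * c) * (INR n - 3 * c)) - 2 * x * K / (INR n - 2 * c)) * m1 +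
     K / ((INR n - 2 * c) * (INR n - 3 * c)) * m2)) by (field; lra).
  apply is_series_Rplus; [|apply is_series_Rplus]; apply is_series_Rscal; assumption. }
assert (Hdev : forall v, Rabs (jain b v y * (a v - f x)) <= B v).
{ intros v; rewrite Rabs_mult, (Rabs_pos_eq (jain b v y)) by (apply jain_pos; lra).
  apply Rmult_le_compat_l; [apply jain_pos; lra|].
  destruct v as [|k]; unfold a.
  - specialize (Hf 0 ltac:(lra)); unfold kernel_var; simpl INR.
    eapply Rle_trans; [exact Hf|]; right; unfold Rdiv; ring.
  - now apply scaled_kernel_deviation. }
assert (HexB : ex_series B) by (eexists; exact HB).
assert (Hexd : ex_series (fun v => jain b v y * (a v - f x))).
{ apply (ex_series_le (fun v => jain b v y * (a v - f x)) B); auto. }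
(* Summability is recovered from that of the deviations, since the weights sum to 1. *)
assert (Hexa : is_series (fun v => jain b v y * a v)
   (Series (fun v => jain b v y * (a v - f x)) + f x * 1)).
{ apply (is_series_Rext (fun v => jain b v y * (a v - f x) + f x * jain b v y)).
  { intros v; ring. }
  apply is_series_Rplus; [now apply Series_correct | now apply is_series_Rscal]. }
assert (HD : D_op n c b f x = Series (fun v => jain b v y * a v)).
{ rewrite Series_incr_1 by (eexists; exact Hexa).
  unfold D_op; fold y; rewrite <- Series_scal_l, Rplus_comm; f_equal.
  apply Series_ext; intros k; unfold a, L, jain; ring. }
rewrite HD, (is_series_unique _ _ Hexa).
replace (_ + f x * 1 - f x) with (Series (fun v => jain b v y * (a v - f x))) by ring.
apply Rle_trans with (Series B).
{ eapply Rle_trans; [apply Series_Rabs|].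
  - apply (ex_series_le (fun v => Rabs (jain b v y * (a v - f x))) B); auto.
    intros v; unfold norm; simpl; rewrite Rabs_Rabsolu; apply Hdev.
  - apply Series_le; auto; intros v; split; [apply Rabs_pos | apply Hdev]. }
rewrite (is_series_unique _ _ HB).
apply Rplus_le_compat_l, Rmult_le_compat_l; [exact HK|].
assert (Hmu2 : 1 <= mu <= 2) by nra.
set (p := / (INR n - 2 * c)); set (q := / (INR n - 3 * c)).
assert (Hp : 0 < p) by (apply Rinv_0_lt_compat; lra).
assert (Hq : 0 < q) by (apply Rinv_0_lt_compat; lra).
assert (HnP : INR n * p = 1 + 2 * c * p) by (unfold p; field; lra).
assert (HnQ : INR n * q = 1 + 3 * c * q) by (unfold q; field; lra).
unfold korovkin_rate; fold mu p q; rewrite <- HnP, <- HnQ.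
unfold Rdiv; rewrite Rinv_mult; fold p q.
(* From [m1 >= n x] and [n p >= 1]. Used twice, it bounds [x^2 - 2 x p m1] by [- x^2], which the
   main part of [m2] then nearly cancels. *)
assert (H1 : x ^ 2 <= x * p * m1).
{ replace (x ^ 2) with (x * (1 * x)) by ring.
  replace (x * p * m1) with (x * (p * m1)) by ring.
  apply Rmult_le_compat_l; [lra|].
  apply Rle_trans with (p * y); [|apply Rmult_le_compat_l; lra].
  unfold y; replace (p * (INR n * x)) with (INR n * p * x) by ring.
  apply Rmult_le_compat_r; [lra|]; rewrite HnP.
  assert (0 < c * p) by (apply Rmult_lt_0_compat; lra); lra. }
(* The 10 is the 8 of [jain_moments] plus 2, because [m1 <= mu y <= 2 y]. *)
assert (H2 : (m2 + m1) * (p * q) <= y * (mu ^ 2 * y + 10) * (p * q)).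
{ apply Rmult_le_compat_r; [apply Rmult_le_pos; lra|]; nra. }
assert (H3 : y * (mu ^ 2 * y + 10) * (p * q) =
  mu ^ 2 * (INR n * p) * (INR n * q) * x ^ 2 + 10 * (INR n * p) * q * x)
  by (unfold y; ring).
assert (HP1 : 1 <= INR n * p).
{ rewrite HnP; assert (0 < c * p) by (apply Rmult_lt_0_compat; lra); lra. }
assert (HQ1 : 1 <= INR n * q).
{ rewrite HnQ; assert (0 < c * q) by (apply Rmult_lt_0_compat; lra); lra. }
(* Nonnegativity of [G - 1] allows [(G - 1) x^2] to be enlarged to [(G - 1) (1 + x^2)]. *)
assert (HG : 1 <= mu ^ 2 * (INR n * p) * (INR n * q)).
{ assert (1 <= mu ^ 2 * (INR n * p)) by nra; nra. }
assert (HH : 0 <= 10 * (INR n * p) * q) by (apply Rmult_le_pos; lra).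
set (G := mu ^ 2 * (INR n * p) * (INR n * q)) in *.
set (H := 10 * (INR n * p) * q) in *.
apply Rle_trans with (G * x ^ 2 - x ^ 2 + H * x); [lra|].
assert (H * x <= H * (1 + x ^ 2)) by (apply Rmult_le_compat_l; nra).
nra.
Qed.

(** * Vanishing of the rate, and quadratic bounds on [f t - f x] *)

Lemma is_lim_seq_inv_shift a : is_lim_seq (fun n => / (INR n - a)) 0.
Proof.
apply (is_lim_seq_inv (fun n => INR n - a) p_infty); [|discriminate].
apply (is_lim_seq_minus INR (fun _ => a) p_infty a).
- apply is_lim_seq_INR.
- apply is_lim_seq_const.
- reflexivity.
Qed.

Lemma is_lim_seq_korovkin_rate c beta : is_lim_seq beta 0 ->
  is_lim_seq (fun n => korovkin_rate n c (beta n)) 0.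
Proof.
intros Hb; unfold korovkin_rate.
assert (Hsh : forall d a, is_lim_seq (fun n => 1 + d * / (INR n - a)) (1 + d * 0)).
{ intros d a; apply (is_lim_seq_plus' (fun _ => 1) (fun n => d * / (INR n - a))).
  - apply is_lim_seq_const.
  - apply (is_lim_seq_scal_l (fun n => / (INR n - a)) d 0), is_lim_seq_inv_shift. }
assert (Hmu : is_lim_seq (fun n => / (1 - beta n)) (/ (1 - 0))).
{ apply (is_lim_seq_inv (fun n => 1 - beta n) (1 - 0)).
  - apply is_lim_seq_minus'; [apply is_lim_seq_const | exact Hb].
  - intros He; injection He; lra. }
(* The limit 0 is spelled factor by factor, with the square unfolded as [u * (u * 1)], to match the
   limit rules. *)
replace (Finite 0) with (Finite (/ (1 - 0) * (/ (1 - 0) * 1)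
   * (1 + 2 * c * 0) * (1 + 3 * c * 0) - 1 + 10 * (1 + 2 * c * 0) * 0)) by (f_equal; field).
apply is_lim_seq_plus'; [apply is_lim_seq_minus'|].
- apply is_lim_seq_mult'; [apply is_lim_seq_mult'; [apply is_lim_seq_mult'|]|]; try apply Hsh.
  + exact Hmu.
  + apply is_lim_seq_mult'; [exact Hmu | apply is_lim_seq_const].
- apply is_lim_seq_const.
- apply is_lim_seq_mult'; [apply is_lim_seq_mult'; [|apply Hsh]|].
  + apply is_lim_seq_const.
  + apply is_lim_seq_inv_shift.
Qed.

(** This rests on [t^2 <= 2 x^2 + 2 (t - x)^2], where the difference of the two sides is
    [(t - 2 x)^2]. *)
Lemma deviation_growth (f : R -> R) M x t :
  (forall x, 0 <= x -> Rabs (f x) <= M * (1 + x ^ 2)) -> 0 <= M -> 0 <= x -> 0 <= t ->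
  Rabs (f t - f x) <= M * (2 + 3 * x ^ 2) + 2 * M * (t - x) ^ 2.
Proof.
intros HM HM0 Hx Ht.
apply Rle_trans with (M * (1 + t ^ 2) + M * (1 + x ^ 2)).
- unfold Rminus; eapply Rle_trans; [apply Rabs_triang|]; rewrite Rabs_Ropp.
  apply Rplus_le_compat; auto.
- assert (H : 0 <= M * (t - 2 * x) ^ 2) by (apply Rmult_le_pos; [lra | apply pow2_ge_0]).
  nra.
Qed.

(** Uniform continuity handles [t] close to [x]. Elsewhere [(t - x)^2] is bounded below, so a large
    [K] absorbs the growth bound. *)
Lemma deviation_compact (f : R -> R) M A e :
  (forall x, 0 <= x -> continuous (fun t => f (Rmax 0 t)) x) ->
  (forall x, 0 <= x -> Rabs (f x) <= M * (1 + x ^ 2)) -> 0 <= M -> 0 <= A -> 0 < e ->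
  exists K, 0 < K /\ forall x t, 0 <= x <= A -> 0 <= t ->
    Rabs (f t - f x) <= e + K * (t - x) ^ 2.
Proof.
intros Hfc HM HM0 HA He.
(* The interval extends to [A + 1] so that it contains every [t >= 0] within distance [d0 <= 1] of a
   point of [[0, A]]. *)
destruct (Heine_cor2 (f := fun t => f (Rmax 0 t)) (a := 0) (b := A + 1)
  (fun x Hx => proj2 (continuity_pt_filterlim _ x) (Hfc x (proj1 Hx)))
  (mkposreal e He)) as [d Hd].
simpl in Hd.
pose (d0 := Rmin d 1).
assert (Hd0 : 0 < d0 <= 1 /\ d0 <= d).
{ unfold d0; pose proof (cond_pos d); pose proof (Rmin_l d 1); pose proof (Rmin_r d 1).
  repeat split; auto; apply Rmin_pos; lra. }
assert (HC : 0 <= M * (2 + 3 * A ^ 2)) by (apply Rmult_le_pos; [|pose proof (pow2_ge_0 A)]; lra).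
assert (Hdd : 0 < d0 ^ 2) by (apply pow_lt; lra).
assert (HC' : 0 <= M * (2 + 3 * A ^ 2) / d0 ^ 2).
{ apply Rmult_le_pos; [auto | left; now apply Rinv_0_lt_compat]. }
(* The quotient by [d0^2] pays for the constant part of the growth bound; the final 1 makes [K]
   positive, as it is later a divisor. *)
exists (2 * M + M * (2 + 3 * A ^ 2) / d0 ^ 2 + 1); split; [lra|].
intros x t Hx Ht; pose proof (pow2_ge_0 (t - x)) as Hsq.
destruct (Rlt_le_dec (Rabs (t - x)) d0) as [Hlt|Hge].
- pose proof Hlt as Hlt'; apply Rabs_lt_between in Hlt'.
  specialize (Hd t x ltac:(lra) ltac:(lra) ltac:(lra)).
  rewrite !Rmax_right in Hd by lra; nra.
- assert (Hge2 : d0 ^ 2 <= (t - x) ^ 2).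
  { rewrite <- (pow2_abs (t - x)); apply pow_incr; lra. }
  pose proof (deviation_growth f M x t HM HM0 ltac:(lra) Ht) as Hgr.
  assert (Hx2 : M * (2 + 3 * x ^ 2) <= M * (2 + 3 * A ^ 2)).
  { apply Rmult_le_compat_l; [lra|]; nra. }
  assert (HE : M * (2 + 3 * A ^ 2) = M * (2 + 3 * A ^ 2) / d0 ^ 2 * d0 ^ 2) by (field; lra).
  assert (M * (2 + 3 * A ^ 2) / d0 ^ 2 * d0 ^ 2 <= M * (2 + 3 * A ^ 2) / d0 ^ 2 * (t - x) ^ 2)
    by (apply Rmult_le_compat_l; auto).
  nra.
Qed.

(** * Uniform convergence, by splitting the half-line at a point [A] *)

Theorem theorem4 :
  forall (c : R), 0 < c ->
  forall (beta : nat -> R),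
    (forall n, 0 <= beta n < 1) ->
    is_lim_seq beta 0 ->
  forall (f : R -> R), C_rho0 f ->
  forall (lam : R), 0 < lam ->
  forall eps : R, 0 < eps ->
  exists N : nat, forall n : nat, (N <= n)%nat ->
    forall x : R, 0 <= x ->
      Rabs (D_op n c (beta n) f x - f x) / Rpower (1 + x ^ 2) (1 + lam) <= eps.
Proof.
intros c Hc beta Hbeta Hlim f [Hcont [[M HM] _]] lam Hlam eps Heps.
pose proof (continuous_Rmax_0 f Hcont) as Hfc.
assert (HM0 : 0 <= M).
{ pose proof (HM 0 ltac:(lra)); pose proof (Rabs_pos (f 0)); simpl in *; lra. }
assert (HQ : 0 < 5 * M / eps + 1).
{ assert (0 <= 5 * M / eps); [|lra].
  apply Rmult_le_pos; [lra | left; now apply Rinv_0_lt_compat]. }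
(* For [x > A] one has [A <= 1 + x^2], so the extra weight is at least [5 M / eps + 1]; the added 1
   keeps the base positive when [M = 0]. *)
set (A := Rpower (5 * M / eps + 1) (/ lam)).
assert (HA : 0 < A) by apply exp_pos.
destruct (deviation_compact f M A (eps / 2) Hfc HM HM0 ltac:(lra) ltac:(lra))
  as [K [HK Hdev]].
(* The bound [eps / (2 K)] on the rate serves [x <= A], the bound 1 serves [x > A]. *)
assert (Hr : 0 < Rmin 1 (eps / (2 * K))).
{ apply Rmin_pos; [lra|]; apply Rdiv_lt_0_compat; lra. }
assert (Hev : eventually (fun n => 3 * c < INR n /\ beta n <= / 2 /\
   korovkin_rate n c (beta n) <= Rmin 1 (eps / (2 * K)))).
{ apply filter_and; [|apply filter_and].
  - pose proof is_lim_seq_INR as HI; apply is_lim_seq_spec in HI; exact (HI (3 * c)).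
  - apply is_lim_seq_spec in Hlim.
    destruct (Hlim (mkposreal (/ 2) ltac:(lra))) as [N HN]; exists N; intros n Hn.
    specialize (HN n Hn); apply Rabs_lt_between in HN; simpl in HN; lra.
  - pose proof (is_lim_seq_korovkin_rate c beta Hlim) as HR; apply is_lim_seq_spec in HR.
    destruct (HR (mkposreal _ Hr)) as [N HN]; exists N; intros n Hn.
    specialize (HN n Hn); apply Rabs_lt_between in HN; simpl in HN; lra. }
destruct Hev as [N HN]; exists N; intros n Hn x Hx.
destruct (HN n Hn) as [Hn3 [Hb Hrate]].
assert (Hb' : 0 <= beta n <= / 2) by (specialize (Hbeta n); lra).
set (r := korovkin_rate n c (beta n)) in *.
assert (Hr1 : r <= 1) by (eapply Rle_trans; [exact Hrate | apply Rmin_l]).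
assert (Hr2 : K * r <= eps / 2).
{ replace (eps / 2) with (K * (eps / (2 * K))) by (field; lra).
  apply Rmult_le_compat_l; [lra|]; eapply Rle_trans; [exact Hrate | apply Rmin_r]. }
assert (Hx2 : 0 <= x ^ 2) by apply pow2_ge_0.
assert (HW1 : 1 <= Rpower (1 + x ^ 2) lam).
{ apply Rle_trans with (Rpower (1 + x ^ 2) 0); [rewrite Rpower_O; lra|].
  apply Rle_Rpower; lra. }
apply Rle_div_l; [apply exp_pos|].
rewrite Rpower_plus, Rpower_1 by lra.
destruct (Rle_lt_dec x A) as [HxA|HxA].
(* Here the deviation is at most [eps / 2 + K r (1 + x^2) <= eps (1 + x^2)], and the extra weight is
   at least 1. *)
- pose proof (D_op_deviation n c (beta n) f x (eps / 2) K M Hc Hn3 Hb' Hx ltac:(lra)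
    Hfc HM (fun t Ht => Hdev x t (conj Hx HxA) Ht)) as HD; fold r in HD.
  apply Rle_trans with (eps * ((1 + x ^ 2) * 1)).
  2: { apply Rmult_le_compat_l; [lra|]; apply Rmult_le_compat_l; lra. }
  assert (K * r * (1 + x ^ 2) <= eps / 2 * (1 + x ^ 2)) by (apply Rmult_le_compat_r; lra).
  nra.
- pose proof (D_op_deviation n c (beta n) f x (M * (2 + 3 * x ^ 2)) (2 * M) M Hc Hn3 Hb' Hx
    ltac:(lra) Hfc HM (fun t Ht => deviation_growth f M x t HM HM0 Hx Ht)) as HD; fold r in HD.
  assert (HWQ : 5 * M / eps + 1 <= Rpower (1 + x ^ 2) lam).
  { replace (5 * M / eps + 1) with (Rpower A lam).
    - apply Rle_Rpower_l; nra.
    - unfold A; rewrite Rpower_mult, Rinv_l, Rpower_1; lra. }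
  assert (H5 : 5 * M <= eps * Rpower (1 + x ^ 2) lam).
  { apply Rmult_le_compat_l with (r := eps) in HWQ; [|lra].
    replace (eps * (5 * M / eps + 1)) with (5 * M + eps) in HWQ by (field; lra); lra. }
  (* With [r <= 1] the deviation is at most [M (2 + 3 x^2) + 2 M (1 + x^2)], which explains the
     factor 5. *)
  apply Rle_trans with (5 * M * (1 + x ^ 2)).
  + assert (2 * M * (r * (1 + x ^ 2)) <= 2 * M * (1 * (1 + x ^ 2))).
    { apply Rmult_le_compat_l; [lra|]; apply Rmult_le_compat_r; lra. }
    nra.
  + replace (eps * ((1 + x ^ 2) * Rpower (1 + x ^ 2) lam)) with
      (eps * Rpower (1 + x ^ 2) lam * (1 + x ^ 2)) by ring.
    apply Rmult_le_compat_r; lra.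
Qed.
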